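(* Let $g:\mathbb{R}^n\to\mathbb{R}^n$, let $m\ge 1$ be an integer, and put $f(x)=g(x)-x$. Assume: (1) $g$ has a fixed point $x^*\in\mathbb{R}^n$, i.e. $g(x^* )=x^*$; (2) $g$ is uniformly Lipschitz continuously differentiable (i.e. $C^1$ with Lipschitz continuous derivative) in a ball $B(\rho)=\{x\in\mathbb{R}^n : \|x-x^*\|_2\le\rho\}$, $\rho>0$; (3) there exists $\kappa\in(0,1)$ such that $\|g(y)-g(x)\|_2\le\kappa\|y-x\|_2$ for all $x,y\in\mathbb{R}^n$. Let $(x_k)$ be a sequence generated by the method $AAoptD(m,AA(1))$ with inner loop iteration $iterN=1$ (described in the context), with damping factors $$\beta_k=\left|\frac{\left(x_k^\alpha-g(x_k^\alpha)\right)\cdot\left[\left(x_k^\alpha-g(x_k^\alpha)\right)-\left(\tilde x_k^\alpha-g(\tilde x_k^\alpha)\right)\right]}{\left\|\left(x_k^\alpha-g(x_k^\alpha)\right)-\left(\tilde x_k^\alpha-g(\tilde x_k^\alpha)\right)\right\|_2}\right|,$$ where the denominators are assumed nonzero and $\beta_k\in(0,1]$, and assume: (4) there exist $M$ and $\epsilon>0$ such that for all $k>m$ the outer coefficients satisfy $\sum_{i=0}^{m-1}|\alpha_i^{(k)}|<M$ and $|\alpha_m^{(k)}|\ge\epsilon$. For each $k$ write $\bar x_0=x_{k+1/2}$ and $\bar x_1=g(\bar x_0)$, and (whenever $f(x_k)\neq 0$ and $f(\bar x_1)\ne 0$) set $$\theta_{k+1}=\frac{\left\|\sum_{i=0}^{m}\alpha_i^{(k)}f(x_{k-m+i})\right\|_2}{\|f(x_k)\|_2},\qquad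 \bar\theta_1=\frac{\|\bar\alpha_0 f(\bar x_0)+\bar\alpha_1 f(\bar x_1)\|_2}{\|f(\bar x_1)\|_2}.$$ Then, up to higher order terms, $$\|f(x_{k+1})\|_2\le\bar\theta_1\,\theta_{k+1}\,\kappa\left[(1-\beta_k)+\kappa\beta_k\right]\|f(x_k)\|_2+\text{high order terms};$$ that is, there is a constant $C$ independent of $k$ such that for all $k>m$ with $f(x_k)\ne0$ and $f(\bar x_1)\neq 0$, $$\|f(x_{k+1})\|_2\le\bar\theta_1\,\theta_{k+1}\,\kappa\left[(1-\beta_k)+\kappa\beta_k\right]\|f(x_k)\|_2+C\left(\sum_{i=0}^{m}\|f(x_{k-m+i})\|_2^2+\|f(\bar x_0)\|_2^2+\|f(\bar x_1)\|_2^2\right).$$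
   Context: The method $AAoptD(m,AA(1))$ with $iterN=1$ is a multiplicative composition of Anderson acceleration with window size $m$ and ''optimized'' damping (outer step) and undamped Anderson acceleration with window size $1$ (inner step). Write $f(x)=g(x)-x$ for the residual. Given $x_0\in\mathbb{R}^n$, set $x_1=g(x_0)$. For $k=1,2,\dots$: Outer step: let $m_k=\min\{m,k\}$ and let $\alpha^{(k)}=(\alpha_0^{(k)},\dots,\alpha_{m_k}^{(k)})^T$ be a solution of $$\min_{\alpha}\left\|\sum_{i=0}^{m_k}\alpha_i f(x_{k-m_k+i})\right\|_2\quad\text{subject to}\quad\sum_{i=0}^{m_k}\alpha_i=1.$$ Set $$x_k^\alpha=\sum_{i=0}^{m_k}\alpha_i^{(k)}x_{k-m_k+i},\qquad \tilde x_k^\alpha=\sum_{i=0}^{m_k}\alpha_i^{(k)}g(x_{k-m_k+i}),$$ and $x_{k+1/2}=x_k^\alpha+\beta_k(\tilde x_k^\alpha-x_k^\alpha)$, with $\beta_k$ the damping factor given by the formula in the claim. Inner step: put $\bar x_0=x_{k+1/2}$, $\bar x_1=g(\bar x_0)$; let $(\bar\alpha_0,\bar\alpha_1)$ be a solution of $\min\|\bar\alpha_0f(\bar x_0)+\bar\alpha_1f(\bar x_1)\|_2$ subject to $\bar\alpha_0+\bar\alpha_1=1$; set $\bar x_2=\bar\alpha_0 g(\bar x_0)+\bar\alpha_1 g(\bar x_1)$. Finally $x_{k+1}=\bar x_2$. The quantities $\bar x_0,\bar x_1,\bar x_2,\bar\alpha_0,\bar\alpha_1,\bar\theta_1$ depend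 on $k$, which is suppressed in the notation. *)

(* Defs.v *)
From HB Require Import structures.
From mathcomp Require Import all_boot all_order all_algebra.
From mathcomp Require Import all_classical all_reals all_analysis.

Set Implicit Arguments.
Unset Strict Implicit.
Unset Printing Implicit Defensive.

Import Order.TTheory GRing.Theory Num.Theory.
Import numFieldNormedType.Exports.

Local Open Scope classical_set_scope.
Local Open Scope ring_scope.

Section Euclidean.
Context {R : realType} {n : nat}.
Implicit Types u v x y : 'rV[R]_n.

Definition dotp u v : R := \sum_(i < n) u 0 i * v 0 i.

(* The library norm `|u| on row vectors is the sup norm, hence a separate
   Euclidean norm. *)
Definition norm2 u : R := Num.sqrt (dotp u u).

Definition ball2 (c : 'rV[R]_n) (r : R) : set 'rV[R]_n :=
  [set x | norm2 (x - c) <= r].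

(* The last inequality, over all v, says that the operator norm of
   'd g x - 'd g y induced by norm2 is at most L * norm2 (x - y).  The
   differential does not depend on the choice of norm on R^n, and its
   continuity on B follows from the Lipschitz bound. *)
Definition lipschitz_C1_on (g : 'rV[R]_n -> 'rV[R]_n) (B : set 'rV[R]_n) :=
  (forall x, B x -> differentiable g x) /\
  exists L : R, forall x y, B x -> B y ->
    forall v, norm2 ('d g x v - 'd g y v) <= L * norm2 (x - y) * norm2 v.

End Euclidean.

Section AAoptD.
Context {R : realType} {n : nat}.
Variable g : 'rV[R]_n -> 'rV[R]_n.

Definition resid (x : 'rV[R]_n) : 'rV[R]_n := g x - x.

(* Only a 0, ..., a p are relevant. *)
Definition is_aa_coef (p : nat) (y : nat -> 'rV[R]_n) (a : nat -> R) :=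
  \sum_(i < p.+1) a i = 1 /\
  forall b : nat -> R, \sum_(i < p.+1) b i = 1 ->
    norm2 (\sum_(i < p.+1) a i *: resid (y i))
      <= norm2 (\sum_(i < p.+1) b i *: resid (y i)).

Variable m : nat.
Variable x : nat -> 'rV[R]_n.
(* alpha k i is alpha_i^(k) in the outer step. *)
Variable alpha : nat -> nat -> R.
(* abar k i (i = 0, 1) is the coefficient bar alpha_i of the inner step
   performed at iteration k. *)
Variable abar : nat -> nat -> R.

Definition mwin (k : nat) : nat := minn m k.

Definition xwin (k i : nat) : 'rV[R]_n := x (k - mwin k + i)%N.

Definition xalpha (k : nat) : 'rV[R]_n :=
  \sum_(i < (mwin k).+1) alpha k i *: xwin k i.

Definition xtalpha (k : nat) : 'rV[R]_n :=
  \sum_(i < (mwin k).+1) alpha k i *: g (xwin k i).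

Definition beta_den (k : nat) : R :=
  norm2 ((xalpha k - g (xalpha k)) - (xtalpha k - g (xtalpha k))).

(* The denominator is the norm, not its square. *)
Definition beta (k : nat) : R :=
  `| dotp (xalpha k - g (xalpha k))
       ((xalpha k - g (xalpha k)) - (xtalpha k - g (xtalpha k)))
     / beta_den k |.

Definition xhalf (k : nat) : 'rV[R]_n :=
  xalpha k + beta k *: (xtalpha k - xalpha k).

Definition xbar0 (k : nat) : 'rV[R]_n := xhalf k.

Definition xbar1 (k : nat) : 'rV[R]_n := g (xbar0 k).

Definition xbar (k i : nat) : 'rV[R]_n :=
  if i is 0%N then xbar0 k else xbar1 k.

Definition xbar2 (k : nat) : 'rV[R]_n :=
  abar k 0%N *: g (xbar0 k) + abar k 1%N *: g (xbar1 k).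

Definition is_AAoptD_AA1 :=
  x 1%N = g (x 0%N) /\
  forall k, (0 < k)%N ->
    [/\ is_aa_coef (mwin k) (xwin k) (alpha k),
        is_aa_coef 1 (xbar k) (abar k)
      & x k.+1 = xbar2 k].

(* theta k is theta_{k+1}. *)
Definition theta (k : nat) : R :=
  norm2 (\sum_(i < m.+1) alpha k i *: resid (x (k - m + i)%N))
    / norm2 (resid (x k)).

Definition theta_bar1 (k : nat) : R :=
  norm2 (abar k 0%N *: resid (xbar0 k) + abar k 1%N *: resid (xbar1 k))
    / norm2 (resid (xbar1 k)).

End AAoptD.

(* Main.v *)
(* Let r(v) = g(x* + v) - g(x* ) - Dg(x* ) v.  Since Dg is Lipschitz on the ball
   and g is Lipschitz everywhere, |r(v)| <= K |v|^2 for every v, not only for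
   small v.  An affine combination cancels the affine part of g, so
   |g(sum a_i y_i) - sum a_i g(y_i)| is at most a constant, depending on
   sum |a_i|, times sum |y_i - x*|^2, and |y_i - x*| <= |f(y_i)| / (1 - kappa).
   With y^a = sum a_i y_i and d = sum a_i f(y_i), write
     f(y^a + b d) = [g(y^a + b d) - g(y^a)] + (1 - b) d
                    + [g(y^a) - sum a_i g(y_i)].
   The bound ((1 - b) + kappa b) |d| + O(sum |f(y_i)|^2) follows, and it serves
   for the outer step (b = beta_k) and for the inner one (b = 1).  The inner
   coefficients are bounded because f(xbar_1) is a contraction of f(xbar_0):
   the two residuals differ by at least (1 - kappa) |f(xbar_0)|. *)
Require Import Defs.
From HB Require Import structures.
From mathcomp Require Import all_boot all_order all_algebra.
From mathcomp Require Import all_classical all_reals all_analysis.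
From mathcomp Require Import ring lra.

Set Implicit Arguments.
Unset Strict Implicit.
Unset Printing Implicit Defensive.

Import Order.TTheory GRing.Theory Num.Theory.
Import numFieldNormedType.Exports.

Local Open Scope classical_set_scope.
Local Open Scope ring_scope.

(** * Euclidean inner product and norm on row vectors *)

Section EuclideanNorm.
Context {R : realType} {n : nat}.
Implicit Types (u v w : 'rV[R]_n) (a : R).

Lemma dotpC u v : dotp u v = dotp v u.
Proof. by apply: eq_bigr => i _; rewrite mulrC. Qed.

Lemma dotp_linear w : linear (dotp w : 'rV[R]_n -> R).
Proof.
move=> a u v; rewrite /dotp scaler_sumr -big_split /=; apply: eq_bigr => i _.
by rewrite !mxE mulrDr; congr (_ + _); rewrite [RHS]mulrCA.
Qed.

(** Makes the generic lemmas on linear maps, differentials included, apply to [dotp w]. *)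
HB.instance Definition _ w :=
  GRing.isLinear.Build R 'rV[R]_n R _ (dotp w) (dotp_linear w).

Lemma dotpDl u v w : dotp (u + v) w = dotp u w + dotp v w.
Proof. by rewrite dotpC linearD /= !(dotpC w). Qed.

Lemma dotpZr a u v : dotp u (a *: v) = a * dotp u v.
Proof. exact: linearZ. Qed.

Lemma dotpZl a u v : dotp (a *: u) v = a * dotp u v.
Proof. by rewrite dotpC dotpZr dotpC. Qed.

Lemma dotp_ge0 u : 0 <= dotp u u.
Proof. by apply: sumr_ge0 => i _; rewrite -expr2 sqr_ge0. Qed.

Lemma norm2_ge0 u : 0 <= norm2 u.
Proof. exact: sqrtr_ge0. Qed.

Lemma sqr_norm2 u : norm2 u ^+ 2 = dotp u u.
Proof. by rewrite sqr_sqrtr // dotp_ge0. Qed.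

Lemma norm2_eq0 u : (norm2 u == 0) = (u == 0).
Proof.
rewrite -sqrf_eq0 sqr_norm2; apply/eqP/eqP => [|->]; last by rewrite linear0.
move/eqP; rewrite psumr_eq0 => [/allP u0|i _]; last by rewrite -expr2 sqr_ge0.
apply/rowP => i; apply/eqP; rewrite mxE.
by have := u0 i (mem_index_enum i); rewrite /= mulf_eq0 orbb.
Qed.

Lemma norm2_0 : norm2 (0 : 'rV[R]_n) = 0.
Proof. by apply/eqP; rewrite norm2_eq0. Qed.

Lemma norm2Z a u : norm2 (a *: u) = `|a| * norm2 u.
Proof. by rewrite /norm2 dotpZr dotpZl mulrA -expr2 sqrtrM ?sqr_ge0 // sqrtr_sqr. Qed.

Lemma norm2N u : norm2 (- u) = norm2 u.
Proof. by rewrite -scaleN1r norm2Z normrN1 mul1r. Qed.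

Lemma dotp_le u v : dotp u v <= norm2 u * norm2 v.
Proof.
have [->|u0] := eqVneq u 0; first by rewrite dotpC linear0 norm2_0 mul0r.
have [->|v0] := eqVneq v 0; first by rewrite linear0 norm2_0 mulr0.
have uv0 : 0 < norm2 u * norm2 v.
  by rewrite mulr_gt0 // lt_neqAle norm2_ge0 eq_sym norm2_eq0 ?u0 ?v0.
(* Cauchy-Schwarz: this square equals 2 |u| |v| (|u| |v| - u.v), and |u| |v| > 0 can be
   cancelled. *)
have := dotp_ge0 (norm2 v *: u - norm2 u *: v).
rewrite linearB /= -scaleNr !dotpDl !dotpZr !dotpZl (dotpC v u) -!sqr_norm2.
move: uv0; set a := norm2 u; set b := norm2 v => ab0.
rewrite (_ : _ - _ = (a * b) * (2 * (a * b - dotp u v))); last by ring.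
by rewrite pmulr_rge0 // pmulr_rge0 // subr_ge0.
Qed.

Lemma ler_norm2D u v : norm2 (u + v) <= norm2 u + norm2 v.
Proof.
rewrite -ler_sqr ?nnegrE ?addr_ge0 ?norm2_ge0 // sqr_norm2 linearD /= !dotpDl.
rewrite sqrrD (dotpC v u) -!sqr_norm2.
have := dotp_le u v; lra.
Qed.

Lemma ler_norm2B u v : norm2 (u - v) <= norm2 u + norm2 v.
Proof. by rewrite -(norm2N v) ler_norm2D. Qed.

Lemma ler_norm2_sum (I : finType) (F : I -> 'rV[R]_n) :
  norm2 (\sum_i F i) <= \sum_i norm2 (F i).
Proof.
elim/big_rec2: _ => [|i a v _ le_va]; first by rewrite norm2_0.
by rewrite (le_trans (ler_norm2D _ _)) // lerD2l.
Qed.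

Lemma dotp_continuous w : continuous (dotp w).
Proof.
have -> : dotp w = \sum_(i < n) (fun v : 'rV[R]_n => w 0 i *: v 0 i).
  by apply/funext => v; rewrite fct_sumE.
move=> u; apply/differentiable_continuous/differentiable_sum => i.
exact/differentiableZ/differentiable_coord.
Qed.

End EuclideanNorm.

(** * First-order expansion at [c]: quadratic remainder and defect of affine combinations *)

Section FirstOrderExpansion.
Context {R : realType} {n : nat}.
Variables (g : 'rV[R]_n -> 'rV[R]_n) (c : 'rV[R]_n).
Implicit Types v w : 'rV[R]_n.

(** Pairing with a fixed [w] reduces [g] along a segment to a real function, to which the mean value
    theorem applies. *)
Lemma is_derive_dotp_segment w v (t : R) : differentiable g (c + t *: v) ->
  is_derive t 1 (fun s : R => dotp w (g (c + s *: v)))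
    (dotp w ('d g (c + t *: v) v)).
Proof.
move=> dg.
have dl : is_diff t (fun s : R => c + s *: v) ( *:%R^~ v).
  have := is_diffD (is_diff_cst c t) (is_diff_scalel t v).
  by rewrite add0r.
have dgl := is_diff_comp dl (differentiableP dg).
have dw : is_diff (g (c + t *: v)) (dotp w) (dotp w).
  apply: DiffDef; first exact/linear_differentiable/dotp_continuous.
  by rewrite diff_lin //; exact: dotp_continuous.
have dh := is_diff_comp dgl dw.
apply: DeriveDef; first exact: diff_derivable.
rewrite deriveE; last exact: ex_diff.
by rewrite (@diff_val _ _ _ _ _ _ _ dh) /= scale1r.
Qed.

Definition remainder v : 'rV[R]_n := g (c + v) - g c - 'd g c v.

(** The mean value theorem for [phi], with [w] the remainder itself, gives |w|^2 = w.(Dg(c + tv) -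
    Dg(c))v for some t in [0, 1]; Cauchy-Schwarz then lets one factor |w| cancel. The bound uses
    [|L|] because the sign of [L] is not prescribed. *)
Lemma remainder_le_in_ball (rho L : R) :
  (forall u, ball2 c rho u -> differentiable g u) ->
  (forall u, ball2 c rho u ->
    forall v, norm2 ('d g u v - 'd g c v) <= L * norm2 (u - c) * norm2 v) ->
  forall v, norm2 v <= rho -> norm2 (remainder v) <= `|L| * norm2 v ^+ 2.
Proof.
move=> dg Lg v v_rho; set w := remainder v.
have in_ball (t : R) : 0 <= t <= 1 -> ball2 c rho (c + t *: v).
  move=> /andP[t0 t1]; rewrite /ball2 /= addrAC subrr add0r norm2Z ger0_norm //.
  by rewrite (le_trans _ v_rho) // ler_piMl // norm2_ge0.
pose phi (t : R) := dotp w (g (c + t *: v)) - t * dotp w ('d g c v).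
have dphi (t : R) : 0 <= t <= 1 ->
    is_derive t 1 phi (dotp w ('d g (c + t *: v) v) - dotp w ('d g c v)).
  move=> t01; apply: is_deriveB.
    exact/is_derive_dotp_segment/dg/in_ball.
  apply: (is_derive_eq (is_deriveM _ _)).
  by rewrite scaler0 add0r; exact: mulr1.
have [t t01||t /[!in_itv]/= t01 phi01] := @MVT_segment R phi
    (fun t : R => dotp w ('d g (c + t *: v) v) - dotp w ('d g c v)) 0 1 ler01.
- by apply: dphi; move: t01; rewrite in_itv /= => /andP[/ltW-> /ltW->].
- apply: continuous_in_subspaceT => t /[!inE] /= /[!in_itv] /= /dphi dphit.
  exact/differentiable_continuous/derivable1_diffP.
- have -> : `|L| * norm2 v ^+ 2 = `|L| * norm2 v * norm2 v by ring.
  have [w0|w0] := eqVneq w 0.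
    by rewrite w0 norm2_0 !mulr_ge0 ?norm2_ge0.
  have w_gt0 : 0 < norm2 w by rewrite lt_neqAle norm2_ge0 eq_sym norm2_eq0 w0.
  rewrite -(ler_pM2l w_gt0) -expr2 sqr_norm2.
  have -> : dotp w w = dotp w ('d g (c + t *: v) v - 'd g c v).
    rewrite subr0 mulr1 in phi01.
    rewrite [RHS]linearB; apply: etrans phi01; rewrite /phi {2}/w /remainder.
    by rewrite scale1r scale0r addr0 !linearB /=; ring.
  rewrite (le_trans (dotp_le _ _)) // ler_wpM2l ?norm2_ge0 //.
  rewrite (le_trans (Lg _ (in_ball _ t01) _)) // ler_wpM2r ?norm2_ge0 //.
  rewrite addrAC subrr add0r norm2Z.
  case/andP: t01 => t0 t1.
  rewrite (le_trans (ler_norm _)) // normrM ler_wpM2l // ger0_norm.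
    by rewrite ger0_norm // ler_piMl // norm2_ge0.
  by rewrite mulr_ge0 ?norm2_ge0.
Qed.

(* Outside the ball the linear part is controlled by rescaling into the ball,
   and [norm2 v <= norm2 v ^+ 2 / rho]. *)
Lemma remainder_le (rho L kappa : R) : 0 < rho -> 0 <= kappa ->
  (forall u, ball2 c rho u -> differentiable g u) ->
  (forall u, ball2 c rho u ->
    forall v, norm2 ('d g u v - 'd g c v) <= L * norm2 (u - c) * norm2 v) ->
  (forall u v, norm2 (g v - g u) <= kappa * norm2 (v - u)) ->
  forall v, norm2 (remainder v) <= 2 * (`|L| + kappa / rho) * norm2 v ^+ 2.
Proof.
move=> rho0 kappa0 dg Lg g_lip v; have v0 := norm2_ge0 v.
have g_lip0 u : norm2 (g (c + u) - g c) <= kappa * norm2 u.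
  by have := g_lip c (c + u); rewrite [c + u - c]addrAC subrr add0r.
have in_ball := remainder_le_in_ball dg Lg.
have [v_rho|v_rho] := leP (norm2 v) rho.
  rewrite (le_trans (in_ball _ v_rho)) // ler_wpM2r ?sqr_ge0 //.
  have L0 := normr_ge0 L; have : 0 <= kappa / rho by rewrite divr_ge0 // ltW.
  by lra.
have v_gt0 : 0 < norm2 v by exact: lt_trans v_rho.
have D_le : norm2 ('d g c v) <= (kappa + `|L| * rho) * norm2 v.
  pose u := (rho / norm2 v) *: v.
  have nu : norm2 u = rho.
    by rewrite norm2Z ger0_norm ?divr_ge0 // 1?ltW // divfK // gt_eqF.
  (* At radius [rho], Dg(c)u is the increment of [g] minus the remainder, and both are already
     bounded. *)
  have Du : norm2 ('d g c u) <= kappa * rho + `|L| * rho ^+ 2.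
    have -> : 'd g c u = (g (c + u) - g c) - remainder u.
      by rewrite /remainder opprB addrC subrK.
    rewrite (le_trans (ler_norm2B _ _)) // lerD //.
      by rewrite -[in leRHS]nu.
    by rewrite -[in leRHS]nu in_ball // nu.
  have -> : 'd g c v = (norm2 v / rho) *: 'd g c u.
    rewrite -linearZ /=; congr ('d g c _).
    by rewrite scalerA mulrA divfK ?gt_eqF // divff ?scale1r // gt_eqF.
  have vrho0 : 0 <= norm2 v / rho by rewrite divr_ge0 // ltW.
  rewrite norm2Z ger0_norm //.
  have -> : (kappa + `|L| * rho) * norm2 v
            = norm2 v / rho * (kappa * rho + `|L| * rho ^+ 2).
    by field; rewrite gt_eqF.
  exact: ler_wpM2l.
have -> : remainder v = (g (c + v) - g c) - 'd g c v by [].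
rewrite (le_trans (ler_norm2B _ _)) // (le_trans (lerD (g_lip0 v) D_le)) //.
have -> : kappa * norm2 v + (kappa + `|L| * rho) * norm2 v
          = (2 * kappa / rho + `|L|) * (rho * norm2 v).
  by field; rewrite gt_eqF.
rewrite ler_pM //.
- by rewrite addr_ge0 // divr_ge0 ?mulr_ge0 // ltW.
- by rewrite mulr_ge0 // ltW.
- by rewrite mulrDr mulrA addrC lerD2r ler_peMl // ler1n.
- by rewrite expr2 ler_wpM2r // ltW.
Qed.

(** In the constant, A^2 comes from the remainder at the combined point [s], and A from the weighted
    sum of the individual remainders. *)
Lemma affine_defect_le (K A : R) (p : nat) (a : 'I_p -> R)
    (y : 'I_p -> 'rV[R]_n) : 0 <= K ->
  (forall v, norm2 (remainder v) <= K * norm2 v ^+ 2) ->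
  \sum_i a i = 1 -> \sum_i `|a i| <= A ->
  norm2 (g (\sum_i a i *: y i) - \sum_i a i *: g (y i))
    <= K * (A ^+ 2 + A) * \sum_i norm2 (y i - c) ^+ 2.
Proof.
move=> K0 r_le a1 aA; set S := \sum_i norm2 (y i - c) ^+ 2.
pose s := \sum_i a i *: (y i - c).
have sum_const (z : 'rV[R]_n) : \sum_i a i *: z = z.
  by rewrite -scaler_suml a1 scale1r.
have gE z : g z = g c + 'd g c (z - c) + remainder (z - c).
  by rewrite /remainder (addrC c) subrK -(addrA (g z)) -opprD [RHS]addrC subrK.
have -> : g (\sum_i a i *: y i) - \sum_i a i *: g (y i)
          = remainder s - \sum_i a i *: remainder (y i - c).
  have sE : \sum_i a i *: y i - c = s.
    rewrite -[X in _ - X]sum_const -sumrB.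
    by apply: eq_bigr => i _; rewrite -scalerBr.
  rewrite gE sE; under [in LHS]eq_bigr => i _ do rewrite gE 2!scalerDr.
  rewrite !big_split /= sum_const opprD addrACA.
  suff -> : 'd g c s = \sum_i a i *: 'd g c (y i - c) by rewrite subrr add0r.
  by rewrite linear_sum; apply: eq_bigr => i _; rewrite linearZ.
have S0 : 0 <= S by apply: sumr_ge0 => i _; exact: sqr_ge0.
have y_le i : norm2 (y i - c) ^+ 2 <= S.
  by rewrite /S (bigD1 i) //= lerDl; apply: sumr_ge0 => j _; exact: sqr_ge0.
have sum_le (b : 'I_p -> R) B : 0 <= B -> (forall i, b i <= B) ->
    \sum_i `|a i| * b i <= A * B.
  move=> B0 bB; rewrite (le_trans (_ : _ <= \sum_i `|a i| * B)) //.
    by apply: ler_sum => i _; rewrite ler_wpM2l.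
  by rewrite -mulr_suml ler_wpM2r.
(* Each |y_i - c| is at most sqrt(S), hence |s| <= A sqrt(S). *)
have s_le : norm2 s ^+ 2 <= A ^+ 2 * S.
  rewrite -[S]sqr_sqrtr // -exprMn ler_sqr ?nnegrE ?norm2_ge0 //; last first.
    by rewrite mulr_ge0 ?sqrtr_ge0 // (le_trans _ aA) // sumr_ge0.
  rewrite (le_trans (ler_norm2_sum _)) //.
  under eq_bigr => i _ do rewrite norm2Z.
  apply: sum_le => [|i]; first exact: sqrtr_ge0.
  by rewrite -[norm2 _]ger0_norm ?norm2_ge0 // -sqrtr_sqr ler_wsqrtr.
have rs_le : norm2 (\sum_i a i *: remainder (y i - c)) <= A * (K * S).
  rewrite (le_trans (ler_norm2_sum _)) //.
  under eq_bigr => i _ do rewrite norm2Z.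
  apply: sum_le => [|i]; first exact: mulr_ge0.
  by rewrite (le_trans (r_le _)) // ler_wpM2l.
rewrite (le_trans (ler_norm2B _ _)) //.
rewrite (_ : _ * S = K * (A ^+ 2 * S) + A * (K * S)); last by ring.
by rewrite lerD // (le_trans (r_le _)) // ler_wpM2l.
Qed.

End FirstOrderExpansion.

(** * Residuals of a contraction and one accelerated step *)

Section Contraction.
Context {R : realType} {n : nat}.
Variables (g : 'rV[R]_n -> 'rV[R]_n) (kappa : R).
Hypothesis kappa01 : 0 < kappa < 1.
Hypothesis g_lip : forall u v, norm2 (g v - g u) <= kappa * norm2 (v - u).

(** In y - c = (g(y) - g(c)) - f(y), the first term has norm at most kappa |y - c| and is absorbed
    on the left. *)
Lemma dist_fixpoint_le (c y : 'rV[R]_n) : g c = c ->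
  norm2 (y - c) <= norm2 (resid g y) / (1 - kappa).
Proof.
move=> gc; case/andP: kappa01 => _ k1.
rewrite ler_pdivlMr ?subr_gt0 // mulrBr mulr1 lerBlDr mulrC.
have {1}-> : y - c = (g y - g c) - resid g y.
  by rewrite gc; apply/rowP => i; rewrite !mxE; ring.
by rewrite (le_trans (ler_norm2B _ _)) // [leLHS]addrC lerD2l g_lip.
Qed.

Lemma resid_contract (y : 'rV[R]_n) :
  norm2 (resid g (g y)) <= kappa * norm2 (resid g y).
Proof. exact: g_lip. Qed.

(** The points are arbitrary here; later [yta] is the combination of the g(y_i), which turns the
    last term into the affine defect. *)
Lemma resid_damped_le (ya yta : 'rV[R]_n) (b : R) : 0 <= b <= 1 ->
  norm2 (resid g (ya + b *: (yta - ya)))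
    <= ((1 - b) + kappa * b) * norm2 (yta - ya) + norm2 (g ya - yta).
Proof.
case/andP=> b0 b1; set z := ya + _; set d := yta - ya.
have -> : resid g z = (g z - g ya) + (1 - b) *: d + (g ya - yta).
  rewrite /resid {2}/z scalerBl scale1r /d; apply/rowP => i; rewrite !mxE.
  by ring.
rewrite (le_trans (ler_norm2D _ _)) // lerD2r (le_trans (ler_norm2D _ _)) //.
rewrite norm2Z ger0_norm ?subr_ge0 //.
have := g_lip ya z; rewrite {2}/z addrAC subrr add0r norm2Z ger0_norm //.
lra.
Qed.

(** Optimality gives |a_0| |d0 - d1| <= 2 |d1|, while |d0 - d1| >= (1 - kappa) |d0| and |d1| <=
    kappa |d0|. So |a_0| <= 2 kappa / (1 - kappa), and |a_1| <= 1 + |a_0|. *)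
Lemma aa1_coef_bound (y : nat -> 'rV[R]_n) (a : nat -> R) :
  is_aa_coef g 1 y a -> y 1%N = g (y 0%N) -> resid g (y 1%N) != 0 ->
  \sum_(i < 2) `|a i| <= 1 + 4 * kappa / (1 - kappa).
Proof.
rewrite /is_aa_coef !big_ord_recl !big_ord0 /= !addr0 => -[a01 amin] y1 d1_neq0.
case/andP: kappa01 => k0 k1; have k1' : 0 < 1 - kappa by rewrite subr_gt0.
set d0 := resid g (y 0%N) in amin; set d1 := resid g (y 1%N) in amin d1_neq0.
have d1_gt0 : 0 < norm2 d1 by rewrite lt_neqAle norm2_ge0 eq_sym norm2_eq0 d1_neq0.
have d1_le : norm2 d1 <= kappa * norm2 d0 by rewrite /d1 y1 resid_contract.
have aE : a 1%N = 1 - a 0%N by rewrite -a01 addrAC subrr add0r.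
have d01 : norm2 d0 <= norm2 (d0 - d1) + norm2 d1.
  by rewrite -[in leLHS](subrK d1 d0) ler_norm2D.
have a0_le : `|a 0%N| * norm2 (d0 - d1) <= 2 * norm2 d1.
  (* The competitor is the pair (0, 1), whose combined residual is [d1]. *)
  have := amin (fun i => i%:R); rewrite !big_ord_recl !big_ord0 /= !addr0 add0r.
  move=> /(_ erefl); rewrite scale0r add0r scale1r -/d0 -/d1 => le_d1.
  rewrite -norm2Z; have -> : a 0%N *: (d0 - d1) = (a 0%N *: d0 + a 1%N *: d1) - d1.
    by rewrite aE; apply/rowP => i; rewrite !mxE; ring.
  by rewrite (le_trans (ler_norm2B _ _)) // mulr_natl mulr2n lerD2r.
have a0 : `|a 0%N| <= 2 * kappa / (1 - kappa).
  (* Multiplying by |d1| > 0 allows |d1| <= kappa |d0| on the left and leaves a common factor |d1|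
     to cancel. *)
  rewrite ler_pdivlMr // -(ler_pM2r d1_gt0).
  have : `|a 0%N| * ((1 - kappa) * norm2 d0) <= 2 * norm2 d1.
    by rewrite (le_trans _ a0_le) // ler_wpM2l // mulrBl mul1r; lra.
  have : `|a 0%N| * (1 - kappa) * norm2 d1 <= `|a 0%N| * (1 - kappa) * (kappa * norm2 d0).
    by rewrite ler_wpM2l // mulr_ge0 // ltW.
  move=> h1 h2; rewrite (le_trans h1) //.
  have := ler_wpM2l (ltW k0) h2; lra.
have : `|a 1%N| <= 1 + `|a 0%N| by rewrite aE (le_trans (ler_normB _ _)) // normr1.
lra.
Qed.

(** [K] is chosen before the window, coefficients, points and damping, which makes the final
    constant independent of k. *)
Lemma aa_step_le (c : 'rV[R]_n) (rho : R) : g c = c -> 0 < rho ->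
  lipschitz_C1_on g (ball2 c rho) ->
  exists2 K : R, 0 <= K &
    forall (p : nat) (a : 'I_p -> R) (y : 'I_p -> 'rV[R]_n) (A b : R),
      \sum_i a i = 1 -> \sum_i `|a i| <= A -> 0 <= b <= 1 ->
      let ya := \sum_i a i *: y i in let yta := \sum_i a i *: g (y i) in
      norm2 (resid g (ya + b *: (yta - ya)))
        <= ((1 - b) + kappa * b) * norm2 (\sum_i a i *: resid g (y i))
           + K * (A ^+ 2 + A) * \sum_i norm2 (resid g (y i)) ^+ 2.
Proof.
move=> gc rho0 [dg [L Lg]]; case/andP: kappa01 => k0 k1.
have c_in : ball2 c rho c by rewrite /ball2 /= subrr norm2_0 ltW.
have r_le := remainder_le rho0 (ltW k0) dg (fun u hu => Lg u c hu c_in) g_lip.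
set K := 2 * _ in r_le.
have K0 : 0 <= K by rewrite mulr_ge0 // addr_ge0 // divr_ge0 // ltW.
(* The divisor comes from replacing squared distances to [c] by squared residuals. *)
exists (K / (1 - kappa) ^+ 2) => [|p a y A b a1 aA b01 /=].
  by rewrite divr_ge0 // sqr_ge0.
set ya := \sum_i a i *: y i; set yta := \sum_i a i *: g (y i).
have -> : \sum_i a i *: resid g (y i) = yta - ya.
  by rewrite -sumrB; apply: eq_bigr => i _; rewrite -scalerBr.
rewrite (le_trans (resid_damped_le _ _ b01)) // lerD2l.
rewrite (le_trans (affine_defect_le y K0 r_le a1 aA)) //.
have A0 : 0 <= A by rewrite (le_trans _ aA) // sumr_ge0.
rewrite (_ : K / _ * _ * _ = K * (A ^+ 2 + A) *
    \sum_i (norm2 (resid g (y i)) / (1 - kappa)) ^+ 2); last first.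
  under [in RHS]eq_bigr => i _ do rewrite expr_div_n.
  by rewrite -mulr_suml; ring.
apply: ler_wpM2l; first by rewrite mulr_ge0 // addr_ge0 // sqr_ge0.
apply: ler_sum => i _.
rewrite ler_sqr ?nnegrE ?norm2_ge0 //; first exact: dist_fixpoint_le.
by rewrite divr_ge0 ?norm2_ge0 // subr_ge0 ltW.
Qed.

End Contraction.

(** * Optimality of the coefficients and composition of the two steps *)

Lemma aa_le_last {R : realType} {n : nat} (g : 'rV[R]_n -> 'rV[R]_n) (p : nat)
    (y : nat -> 'rV[R]_n) (a : nat -> R) : is_aa_coef g p y a ->
  norm2 (\sum_(i < p.+1) a i *: resid g (y i)) <= norm2 (resid g (y p)).
Proof.
(* The competitor puts all its weight on the last point. *)
case=> _ /(_ (fun i => (i == p)%:R)) a_min; apply: le_trans (a_min _) _.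
  by rewrite big_ord_recr /= eqxx big1 ?add0r // => i _; rewrite ltn_eqF.
rewrite big_ord_recr /= eqxx scale1r big1 ?add0r // => i _.
by rewrite ltn_eqF ?scale0r.
Qed.

Theorem theorem3 (R : realType) (n m : nat) (g : 'rV[R]_n -> 'rV[R]_n)
    (xstar : 'rV[R]_n) (rho kappa : R)
    (x : nat -> 'rV[R]_n) (alpha abar : nat -> nat -> R)
    (hm : (1 <= m)%N)
    (hfix : g xstar = xstar)
    (hrho : 0 < rho)
    (hC1 : lipschitz_C1_on g (ball2 xstar rho))
    (hkappa : 0 < kappa < 1)
    (hcontr : forall u v : 'rV[R]_n, norm2 (g v - g u) <= kappa * norm2 (v - u))
    (hrun : is_AAoptD_AA1 g m x alpha abar)
    (hden : forall k, (1 <= k)%N -> beta_den g m x alpha k != 0)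
    (hbeta : forall k, (1 <= k)%N -> 0 < beta g m x alpha k <= 1)
    (hcoef : exists M eps : R, 0 < eps /\
       forall k, (m < k)%N ->
         \sum_(i < m) `|alpha k i| < M /\ eps <= `|alpha k m|) :
  exists C : R, forall k, (m < k)%N ->
    resid g (x k) != 0 -> resid g (xbar1 g m x alpha k) != 0 ->
    norm2 (resid g (x k.+1)) <=
      theta_bar1 g m x alpha abar k * theta g m x alpha k * kappa *
        ((1 - beta g m x alpha k) + kappa * beta g m x alpha k) *
        norm2 (resid g (x k))
      + C * (\sum_(i < m.+1) norm2 (resid g (x (k - m + i)%N)) ^+ 2
             + norm2 (resid g (xbar0 g m x alpha k)) ^+ 2
             + norm2 (resid g (xbar1 g m x alpha k)) ^+ 2).
Proof.
have [K K0 step] := aa_step_le hkappa hcontr hfix hrho hC1.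
have [M [eps [_ coefM]]] := hcoef; have [_ run] := hrun.
case/andP: (hkappa) => k0 k1.
pose D A := K * (A ^+ 2 + A); pose A1 := 1 + 4 * kappa / (1 - kappa).
(* One summand for each step: 1 + 2M bounds the outer coefficient sum, [A1] the inner one. *)
exists (D (1 + 2 * M) + D A1) => k mk fk0 fb0.
have [outer inner xk1] := run k (leq_ltn_trans (leq0n m) mk).
(* For k > m the window is full. *)
have mwinE : mwin m k = m by apply/minn_idPl/ltnW.
set b := beta g m x alpha k; set y0 := xbar0 g m x alpha k.
set y1 := xbar1 g m x alpha k in fb0 *; set F := resid g.
have b01 : 0 <= b <= 1 by have /andP[/ltW -> ->] := hbeta k (leq_ltn_trans (leq0n m) mk).
have theta_bar_le1 : theta_bar1 g m x alpha abar k <= 1.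
  have := aa_le_last inner; rewrite !big_ord_recl big_ord0 /= addr0 => h.
  rewrite /theta_bar1 ler_pdivrMr ?mul1r //.
  by rewrite lt_neqAle norm2_ge0 eq_sym norm2_eq0 fb0.
have theta_bar_ge0 : 0 <= theta_bar1 g m x alpha abar k.
  by rewrite divr_ge0 ?norm2_ge0.
have inner_le : norm2 (F (x k.+1)) <=
    kappa * (theta_bar1 g m x alpha abar k * norm2 (F y1))
    + D A1 * (norm2 (F y0) ^+ 2 + norm2 (F y1) ^+ 2).
  have a1 : \sum_(i < 2) abar k i = 1 by case: inner.
  have aA := aa1_coef_bound hkappa hcontr inner erefl fb0.
  have b1 : 0 <= (1 : R) <= 1 by rewrite ler01 lexx.
  (* With b = 1 the damped point is [xbar2], that is x_{k+1}, and the factor (1 - b) + kappa b is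
     kappa. *)
  have := step _ _ (fun i : 'I_2 => xbar g m x alpha k i) _ 1 a1 aA b1.
  rewrite /= scale1r addrC subrK subrr add0r mulr1 !big_ord_recl !big_ord0 /=.
  rewrite !addr0 -/(xbar2 g m x alpha abar k) -xk1.
  by rewrite /theta_bar1 divfK // norm2_eq0.
have outer_le : norm2 (F y0) <=
    ((1 - b) + kappa * b) * (theta g m x alpha k * norm2 (F (x k)))
    + D (1 + 2 * M) * \sum_(i < m.+1) norm2 (F (x (k - m + i)%N)) ^+ 2.
  have a1 : \sum_(i < m.+1) alpha k i = 1 by case: outer; rewrite mwinE.
  (* Since the coefficients sum to 1, the last one is at most 1 + M in absolute value. *)
  have aA : \sum_(i < m.+1) `|alpha k i| <= 1 + 2 * M.
    have [M_lt _] := coefM k mk.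
    have : `|alpha k m| <= 1 + \sum_(i < m) `|alpha k i|.
      have -> : alpha k m = 1 - \sum_(i < m) alpha k i.
        by rewrite -a1 big_ord_recr /= addrAC subrr add0r.
      by rewrite (le_trans (ler_normB _ _)) // normr1 lerD2l ler_norm_sum.
    rewrite big_ord_recr /=; lra.
  have := step _ _ (fun i : 'I_m.+1 => x (k - m + i)%N) _ b a1 aA b01.
  rewrite /= /theta divfK ?norm2_eq0 // /y0 /xbar0 /xhalf.
  by rewrite /xalpha /xtalpha /xwin mwinE.
(* The factor kappa of the claim is already supplied by [inner_le], so monotonicity suffices to link
   the two steps. *)
have y1_le : norm2 (F y1) <= norm2 (F y0).
  rewrite (le_trans (resid_contract hcontr _)) // ler_piMl ?norm2_ge0 // ltW //.
set S := \sum_(i < m.+1) _ in outer_le *.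
have D0 A : 0 <= A -> 0 <= D A.
  by move=> A0; rewrite mulr_ge0 // addr_ge0 // sqr_ge0.
have S0 : 0 <= S by apply: sumr_ge0 => i _; exact: sqr_ge0.
have M0 : 0 <= M.
  have [/ltW M_gt _] := coefM k mk.
  by rewrite (le_trans _ M_gt) // sumr_ge0.
have D20 : 0 <= D A1.
  by rewrite D0 // addr_ge0 // divr_ge0 ?mulr_ge0 ?subr_ge0 // ltW.
have D10 : 0 <= D (1 + 2 * M) by rewrite D0 // addr_ge0 // mulr_ge0.
rewrite (le_trans inner_le) //.
set tb := theta_bar1 _ _ _ _ _ _ in theta_bar_le1 theta_bar_ge0 *.
have ktb0 : 0 <= kappa * tb by rewrite mulr_ge0 // ltW.
have ktb1 : kappa * tb <= 1 by rewrite mulr_ile1 // ltW.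
have h1 := ler_wpM2l ktb0 (le_trans y1_le outer_le).
(* The inner step does not amplify the outer error, as kappa times [tb] is at most 1. The
   nonnegative cross terms [h3] and [h4] then complete the product of the single constant with all
   the squares. *)
have h2 := ler_wpM2r (mulr_ge0 D10 S0) ktb1.
have h3 : 0 <= D A1 * S by rewrite mulr_ge0.
have h4 : 0 <= D (1 + 2 * M) * (norm2 (F y0) ^+ 2 + norm2 (F y1) ^+ 2).
  by rewrite mulr_ge0 // addr_ge0 // sqr_ge0.
lra.
Qed.
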